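(* Let $H^4=\{(p_0,p_1,p_2,p_3)\in\mathbb{R}^4 : p_0>0\}$ be the upper half-space model of hyperbolic $4$-space of constant curvature $-1$, let $N=\{p\in H^4: p_0=1\}\simeq\mathbb{R}^3$ and $U=\{p\in H^4: 0<p_0<1\}$. Let $v$ be the unit vector field on $N\simeq\mathbb{R}^3$ given by $$v(x,y,z)=\frac{1}{x^2+y^2+z^2+1}\left(x^2-y^2-z^2+1,\;2xy+2z,\;2xz-2y\right).$$ Then $v$ bifoliates $U$. Moreover, for the associated outer billiard map $B:U\to U$ and fixed $h\in(0,1)$, we have: (a) For $m\in\mathbb{Z}$ and $x\in\mathbb{R}$, $B^m(h,x,0,0)=(h,x+2m\sqrt{1-h^2},0,0)$; in particular the orbit of $(h,x,0,0)$ is unbounded. (b) The map $B$ preserves the circle $C_h=\{(h,x,y,z) : y^2+z^2=2-h^2,\ x=0\}$. (c) The restriction of $B$ to $C_h$ is a rotation by angle $\theta_h=2\arctan\left(\sqrt{1-h^2}\right)$, and hence the orbits on $C_h$ are periodic if and only if $\theta_h$ is a rational multiple of $\pi$.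
   Context: The metric on $H^4$ is $(dp_0^2+\cdots+dp_3^2)/p_0^2$; the horosphere $N=\{p_0=1\}$ with its induced metric is identified with Euclidean $\mathbb{R}^3$ via $(1,x,y,z)\leftrightarrow(x,y,z)$, and tangent vectors are identified accordingly. ($v$ is the normalization of the image of the Hopf vector field $V(t,x,y,z)=(-x,t,-z,y)$ on $S^3$ under stereographic projection $F(t,x,y,z)=\frac{1}{1-t}(x,y,z)$.) For $u\in TH^4$, $\gamma_u$ denotes the geodesic of $H^4$ with initial velocity $u$. The unit vector field $v$ on $N$ bifoliates $U$ if the geodesic rays $\gamma_{v(p)}(0,\infty)$, $p\in N$, are the leaves of a smooth foliation of $U$, and likewise the rays $\gamma_{-v(p)}(0,\infty)$, $p\in N$, are the leaves of a smooth foliation of $U$. The associated outer billiard map $B:U\to U$ is defined by $B(\gamma_{v(p)}(-t))=\gamma_{v(p)}(t)$ for $(p,t)\in N\times(0,\infty)$. *)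

(* Defs.v *)
From HB Require Import structures.
From mathcomp Require Import all_boot all_order all_algebra.
From mathcomp Require Import all_classical all_reals all_analysis.

Set Implicit Arguments.
Unset Strict Implicit.
Unset Printing Implicit Defensive.

Import Order.TTheory GRing.Theory Num.Theory.
Import numFieldNormedType.Exports.

Local Open Scope ring_scope.
Local Open Scope classical_set_scope.

(* Points and tangent vectors of R^n.+1 are row vectors.  The norm carried by *)
(* 'rV[R]_n.+1 is the sup norm; only its topology matters below, except in    *)
(* bounded_set, where all norms are equivalent.                               *)

Section smooth_maps.
Variable R : realType.

Definition partial n (i : 'I_n.+1) (f : 'rV[R]_n.+1 -> R) : 'rV[R]_n.+1 -> R :=
  'D_(delta_mx 0 i) f.

Definition iter_partial n (s : seq 'I_n.+1) (f : 'rV[R]_n.+1 -> R) :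
  'rV[R]_n.+1 -> R := foldr (@partial n) f s.

(* To be used with W open: all iterated partial derivatives exist and are     *)
(* continuous at every point of W.                                            *)
Definition smooth_on n (W : set 'rV[R]_n.+1) (f : 'rV[R]_n.+1 -> R) : Prop :=
  forall (s : seq 'I_n.+1) (x : 'rV[R]_n.+1), W x ->
    {for x, continuous (iter_partial s f)} /\
    forall i : 'I_n.+1, derivable (iter_partial s f) x (delta_mx 0 i).

Definition smooth_map_on n m (W : set 'rV[R]_n.+1)
    (f : 'rV[R]_n.+1 -> 'rV[R]_m.+1) : Prop :=
  forall j : 'I_m.+1, smooth_on W (fun x => f x 0 j).

Definition diffeo_on n (W D : set 'rV[R]_n.+1)
    (phi : 'rV[R]_n.+1 -> 'rV[R]_n.+1) : Prop :=
  [/\ open W, open D, smooth_map_on W phi &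
      exists psi : 'rV[R]_n.+1 -> 'rV[R]_n.+1,
        [/\ smooth_map_on D psi,
            (forall x, W x -> D (phi x) /\ psi (phi x) = x) &
            (forall y, D y -> W (psi y) /\ phi (psi y) = y)]].

End smooth_maps.

Section foliations.
Variable R : realType.

(* Open box, with possibly unbounded sides. *)
Definition open_box n (D : set 'rV[R]_n.+1) : Prop :=
  exists J : 'I_n.+1 -> set R,
    (forall i, open (J i) /\ is_interval (J i)) /\
    D = [set y | forall i, J i (y 0 i)].

Definition path_connected n (L : set 'rV[R]_n.+1) : Prop :=
  forall a b, L a -> L b ->
    exists c : R -> 'rV[R]_n.+1,
      [/\ {within `[0, 1], continuous c}, c 0 = a, c 1 = b &
          forall t, 0 <= t <= 1 -> L (c t)].

(* The set F of subsets of U is the set of leaves of a smooth foliation of    *)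
(* dimension d of U: F partitions U, leaves are connected, and around every   *)
(* point there is a smooth chart onto an open box in which each connected     *)
(* component of the trace of a leaf is a slice where the coordinates of index *)
(* >= d are constant.  As these components are slices, a continuous path in   *)
(* a leaf stays locally in one slice, so that path connectedness of L is      *)
(* connectedness for the leaf topology, not just for the induced one.         *)
Definition smooth_foliation n (d : nat) (U : set 'rV[R]_n.+1)
    (F : set (set 'rV[R]_n.+1)) : Prop :=
  [/\ (forall L, F L -> [/\ L !=set0, L `<=` U & path_connected L]),
      (forall x, U x -> exists2 L, F L & L x),
      (forall L L', F L -> F L' -> L `&` L' !=set0 -> L = L') &
      (forall x, U x ->
        exists (W D : set 'rV[R]_n.+1) (phi : 'rV[R]_n.+1 -> 'rV[R]_n.+1),
          [/\ W x, W `<=` U, open_box D, diffeo_on W D phi &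
              forall L, F L -> forall y, (L `&` W) y ->
                connected_component (L `&` W) y =
                [set z | W z /\
                         forall i : 'I_n.+1, (d <= i)%N ->
                           phi z 0 i = phi y 0 i]])].

End foliations.

Section geodesics.
Variable R : realType.

(* Levi-Civita connection of the metric g: Gamma^k_(i j) at q. *)
Definition christoffel n (g : 'rV[R]_n.+1 -> 'M[R]_n.+1)
    (q : 'rV[R]_n.+1) (k i j : 'I_n.+1) : R :=
  2^-1 * \sum_(l < n.+1) invmx (g q) k l *
    (partial i (fun x => g x j l) q + partial j (fun x => g x i l) q
     - partial l (fun x => g x i j) q).

Definition is_geodesic n (M : set 'rV[R]_n.+1)
    (g : 'rV[R]_n.+1 -> 'M[R]_n.+1) (c : R -> 'rV[R]_n.+1) : Prop :=
  forall t : R,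
    [/\ M (c t), derivable c t 1, derivable (derive1 c) t 1 &
        forall k : 'I_n.+1,
          derive1 (derive1 c) t 0 k =
          - \sum_(i < n.+1) \sum_(j < n.+1)
              christoffel g (c t) k i j * derive1 c t 0 i * derive1 c t 0 j].

(* The complete geodesic starting at p with velocity u; only meaningful when *)
(* it exists and is unique, as is the case in hyperbolic space.               *)
Definition geodesic n (M : set 'rV[R]_n.+1) (g : 'rV[R]_n.+1 -> 'M[R]_n.+1)
    (p u : 'rV[R]_n.+1) : R -> 'rV[R]_n.+1 :=
  xget (fun=> p) [set c | [/\ is_geodesic M g c, c 0 = p & derive1 c 0 = u]].

End geodesics.

Section hyperbolic_space.
Variable R : realType.

Definition H4 : set 'rV[R]_4 := [set p | 0 < p 0 0].

Definition hyp_metric (p : 'rV[R]_4) : 'M[R]_4 := ((p 0 0) ^- 2)%:M.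

Definition lower : set 'rV[R]_4 := [set p | 0 < p 0 0 < 1].

Definition pt4 (h x y z : R) : 'rV[R]_4 := \row_(i < 4) [:: h; x; y; z]`_i.

Definition pt3 (x y z : R) : 'rV[R]_3 := \row_(i < 3) [:: x; y; z]`_i.

(* The horosphere N = {p_0 = 1} is parametrized by R^3; a vector field on N   *)
(* is a map R^3 -> R^3.                                                       *)
Definition horo_point (p : 'rV[R]_3) : 'rV[R]_4 := row_mx (1%:M : 'M[R]_1) p.

Definition horo_vector (w : 'rV[R]_3) : 'rV[R]_4 := row_mx (0 : 'M[R]_1) w.

Definition horo_geodesic (v : 'rV[R]_3 -> 'rV[R]_3) (p : 'rV[R]_3) :
  R -> 'rV[R]_4 :=
  geodesic H4 hyp_metric (horo_point p) (horo_vector (v p)).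

Definition horo_rays (v : 'rV[R]_3 -> 'rV[R]_3) : set (set 'rV[R]_4) :=
  range (fun p => horo_geodesic v p @` [set t | 0 < t]).

Definition bifoliates (v : 'rV[R]_3 -> 'rV[R]_3) (U : set 'rV[R]_4) : Prop :=
  smooth_foliation 1 U (horo_rays v) /\
  smooth_foliation 1 U (horo_rays (fun p => - v p)).

(* B is determined on U when v bifoliates U, and is irrelevant outside U. *)
Definition is_outer_billiard (v : 'rV[R]_3 -> 'rV[R]_3) (U : set 'rV[R]_4)
    (B : 'rV[R]_4 -> 'rV[R]_4) : Prop :=
  (forall q, U q -> U (B q)) /\
  forall (p : 'rV[R]_3) (t : R), 0 < t ->
    B (horo_geodesic v p (- t)) = horo_geodesic v p t.

(* B^m for a bijection B of U; negative powers use the inverse of B : U -> U. *)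
Definition iterz (U : set 'rV[R]_4) (B : 'rV[R]_4 -> 'rV[R]_4) (m : int) :
  'rV[R]_4 -> 'rV[R]_4 :=
  match m with
  | Posz n => iter n B
  | Negz n => iter n.+1 ('pinv_id U B)
  end.

(* Up to sign, the normalized image of the Hopf field (-x, t, -z, y) of S^3   *)
(* under the stereographic projection (t, x, y, z) |-> (x, y, z) / (1 - t).   *)
Definition hopf_field (p : 'rV[R]_3) : 'rV[R]_3 :=
  let x := p 0 0 in let y := p 0 1 in let z := p 0 2%:R in
  (x ^+ 2 + y ^+ 2 + z ^+ 2 + 1)^-1 *:
    pt3 (x ^+ 2 - y ^+ 2 - z ^+ 2 + 1) (2 * x * y + 2 * z)
        (2 * x * z - 2 * y).

Definition hopf_circle (h : R) : set 'rV[R]_4 :=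
  [set pt4 h 0 yz.1 yz.2 | yz in
     [set yz : R * R | yz.1 ^+ 2 + yz.2 ^+ 2 = 2 - h ^+ 2]].

(* Rotation by theta of the plane {(h, 0, y, z)}, oriented by (z, y).         *)
Definition rotate (theta h y z : R) : 'rV[R]_4 :=
  pt4 h 0 (cos theta * y + sin theta * z) (- sin theta * y + cos theta * z).

End hyperbolic_space.

(* Main.v *)
(* A geodesic issuing from (1, p) with unit horizontal velocity w is            *)
(* t |-> (sech t, p + tanh t w): x' / y^2 and the energy are first integrals,   *)
(* and then a = 1 / y satisfies a'' = a.  So at height h the rays of v meet the *)
(* horosphere in the image of p |-> p + s v(p), with s = sqrt (1 - h^2), and    *)
(* everything rests on inverting this map explicitly: for p = (x, w) with       *)
(* w = y + i z, it sends (x, w) to (X - s, w (1 - i X) / (1 - i x)), where      *)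
(* X = x + 2 s (1 + x^2) / (1 + |p|^2), and x is a rational function of X and   *)
(* of the norm of the image.  The inverse is thus smooth, and gives a global    *)
(* chart of U in which the rays are vertical.  Along the axis, v is constant;   *)
(* on the circles, B multiplies w by (1 - i s) / (1 + i s).                     *)

Require Import Defs.
From HB Require Import structures.
From mathcomp Require Import all_boot all_order all_algebra.
From mathcomp Require Import all_classical all_reals all_analysis.
From mathcomp Require Import ring lra.

Set Implicit Arguments.
Unset Strict Implicit.
Unset Printing Implicit Defensive.

Import Order.TTheory GRing.Theory Num.Theory.
Import numFieldNormedType.Exports.

Local Open Scope ring_scope.
Local Open Scope classical_set_scope.

(** The geodesic from $(1,p)$ with horizontal unit velocity $w$ is
    $t\mapsto(\operatorname{sech}t,\,p+\tanh t\,w)$; [geodesic_horo] proves this by integrating the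
    geodesic system. Reversing $t$ changes $w$ into $-w$, so both families of rays are handled
    together, with a sign [e]. A point at height $h$ lies on the ray over $p$ exactly when its
    horizontal part is $p+e\,s\,v(p)$, where $s=\sqrt{1-h^2}$. Bifoliation thus amounts to inverting
    $p\mapsto p+s\,v(p)$, smoothly in $s$ and for both signs.

    Write $p=(x,w)$ with $w=y+iz$. The ratio $\rho=|w|^2/(1+x^2)$ does not change when $x$ becomes
    $X=x+2s/(1+\rho)$ and $w$ becomes $w(1-iX)/(1-ix)$; the map in question is this change followed
    by $X\mapsto X-s$. So $X$ and $\rho$ can be read off the image, and then $x$ and $w$ are
    recovered ([hopf_pushK], [hopf_pullK]). The resulting chart [straighten] turns rays into
    verticals ([foliation_horo_rays]), and $B$ is one chart followed by the inverse of the other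
    ([outer_billiardP]).

    On the axis $v=(1,0,0)$, so $B$ translates by $2s$. Along the unit circle $x=0$, $|w|=1$, the
    field is tangent to the circle, and $C_h$, of radius $\sqrt{1+s^2}$, consists of the ends of
    tangent segments of length $s$. There $B$ is the planar outer billiard of the unit circle, a
    rotation by $2\arctan s$ ([billiard_circle]), and [mulrn_2pi] decides periodicity. *)

(** * Smoothness of functions given by formulas *)

Section Elementary.
Variables (R : realType) (n : nat) (W : set 'rV[R]_n.+1).
Implicit Types f g : 'rV[R]_n.+1 -> R.

(** This class is stable under partial derivatives, up to equality on [W], and so yields all the
    iterated derivatives required by [smooth_on]. *)
Inductive elementary : ('rV[R]_n.+1 -> R) -> Prop :=
| elementary_coord i : elementary (fun x => x 0 i)
| elementary_cst c : elementary (fun=> c)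
| elementary_add f g :
    elementary f -> elementary g -> elementary (fun x => f x + g x)
| elementary_mul f g :
    elementary f -> elementary g -> elementary (fun x => f x * g x)
| elementary_inv f : (forall x, W x -> f x != 0) ->
    elementary f -> elementary (fun x => (f x)^-1)
| elementary_sqrt f : (forall x, W x -> 0 < f x) ->
    elementary f -> elementary (fun x => Num.sqrt (f x)).

Lemma elementary_opp f : elementary f -> elementary (fun x => - f x).
Proof.
move=> ef; have -> : (fun x => - f x) = (fun x => -1 * f x).
  by apply/funext => x; rewrite mulN1r.
exact/elementary_mul/ef/elementary_cst.
Qed.

Lemma elementary_exp f k : elementary f -> elementary (fun x => f x ^+ k).
Proof.
move=> ef; elim: k => [|k IH]; first exact: elementary_cst.
have -> : (fun x => f x ^+ k.+1) = (fun x => f x * f x ^+ k).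
  by apply/funext => x; rewrite exprS.
exact: elementary_mul.
Qed.

Lemma is_diff_sqrt f x : 0 < f x -> differentiable f x ->
  is_diff x (fun x => Num.sqrt (f x)) ((2 * Num.sqrt (f x))^-1 \*: 'd f x).
Proof.
move=> fx0 df.
have ds := is_derive1_sqrt fx0.
have dsq : differentiable (@Num.sqrt R) (f x).
  by apply/derivable1_diffP; case: ds.
apply: DiffDef; first exact: (differentiable_comp df dsq).
rewrite [LHS](diff_comp df dsq); apply/funext => y /=.
have <- : 'D_1 (@Num.sqrt R) (f x) = (2 * Num.sqrt (f x))^-1 by exact: derive_val.
rewrite (deriveE _ dsq) -{1}['d f x y]mulr1.
by rewrite -['d f x y * 1]/('d f x y *: (1 : R)) linearZ /GRing.scale/= mulrC.
Qed.

Lemma elementary_differentiable f x :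
  elementary f -> W x -> differentiable f x.
Proof.
move=> ef Wx; elim: ef => [i|c|f1 g _ df _ dg|f1 g _ df _ dg|f1 f0 _ df|f1 f0 _ df].
- exact: differentiable_coord.
- exact: differentiable_cst.
- exact: differentiableD.
- exact: differentiableM.
- exact/differentiableV/f0.
- by have [] := is_diff_sqrt (f0 _ Wx) df.
Qed.

Lemma elementary_partial i f : elementary f ->
  exists2 g, elementary g & forall x, W x -> partial i f x = g x.
Proof.
have diff g x := @elementary_differentiable g x.
elim=> [j|c|f1 g1 ef [f' ef' ff'] eg [g' eg' gg']|f1 g1 ef [f' ef' ff'] eg [g' eg' gg']|
  f1 f0 ef [f' ef' ff']|f1 f0 ef [f' ef' ff']].
- exists (fun=> (i == j)%:R); first exact: elementary_cst.
  move=> x Wx; rewrite /partial.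
  have d : derivable (id : 'rV[R]_n.+1 -> _) x (delta_mx 0 i).
    exact: derivable_id.
  have := derive_mx d; rewrite derive_id => /matrixP/(_ 0 j).
  by rewrite !mxE eqxx/= eq_sym => <-.
- exists (fun=> 0); first exact: elementary_cst.
  by move=> x Wx; rewrite /partial derive_cst.
- exists (fun x => f' x + g' x); first exact: elementary_add.
  move=> x Wx; rewrite -ff'// -gg'// /partial.
  by rewrite (@deriveD _ _ _ f1 g1)//; apply/diff_derivable/diff.
- exists (fun x => f1 x * g' x + g1 x * f' x).
    by apply: elementary_add; apply: elementary_mul.
  move=> x Wx; rewrite -ff'// -gg'// /partial.
  by rewrite (@deriveM _ _ f1 g1)//; apply/diff_derivable/diff.
- exists (fun x => - ((f1 x)^-1 ^+ 2) * f' x).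
    apply: elementary_mul => //; apply: elementary_opp.
    exact/elementary_exp/elementary_inv.
  move=> x Wx; rewrite -ff'// /partial deriveV ?exprVn//; first exact: f0.
  exact/diff_derivable/diff.
- exists (fun x => (2 * Num.sqrt (f1 x))^-1 * f' x).
    apply: elementary_mul => //; apply: elementary_inv.
      by move=> x Wx; rewrite mulf_neq0 ?sqrtr_eq0 -?ltNge ?f0 ?pnatr_eq0.
    by apply: elementary_mul; [exact: elementary_cst|exact: elementary_sqrt].
  move=> x Wx; rewrite -ff'// /partial.
  have df := diff _ _ ef Wx.
  have ds := is_diff_sqrt (f0 _ Wx) df.
  rewrite deriveE; last by case: ds.
  by rewrite (@diff_val _ _ _ _ _ _ _ ds) [in RHS]deriveE.
Qed.

Hypothesis oW : open W.

Lemma elementary_smooth f : elementary f -> smooth_on W f.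
Proof.
move=> ef s.
have [g eg fg] : exists2 g, elementary g &
    forall x, W x -> iter_partial s f x = g x.
  elim: s => [|i s [g eg sg]]; first by exists f.
  have [h eh gh] := elementary_partial i eg.
  exists h => // x Wx; rewrite -gh// /iter_partial/= {1}/partial.
  (* An equality known on [W] can be differentiated because [W] is open. *)
  by apply: near_eq_derive; near do apply: sg; exact: open_nbhs_nbhs.
move=> x Wx; have Wn : nbhs x W by exact: open_nbhs_nbhs.
have gd := elementary_differentiable eg Wx.
have gf : {near x, g =1 iter_partial s f}.
  by apply: filterS Wn => y Wy; rewrite fg.
split=> [|i]; last exact/(near_eq_derivable gf)/diff_derivable.
rewrite /prop_for/continuous_at (fg _ Wx).
exact: cvg_trans (near_eq_cvg gf) (differentiable_continuous gd).
Unshelve. all: by end_near. Qed.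

End Elementary.

(** * Differentiation rules in one variable *)

Section Derivatives.
Variable R : realType.
Implicit Types (f g : R -> R) (t : R).

(** This rule and the next three display the function as [fun t => ...], so that derivatives of
    compound expressions can be assembled as terms and then normalized by [is_derive_eq]. *)
Lemma is_derive1M f g t df dg : is_derive t 1 f df -> is_derive t 1 g dg ->
  is_derive t 1 (fun t => f t * g t) (f t * dg + g t * df).
Proof. by move=> hf hg; exact: is_deriveM. Qed.

Lemma is_derive1D f g t df dg : is_derive t 1 f df -> is_derive t 1 g dg ->
  is_derive t 1 (fun t => f t + g t) (df + dg).
Proof. by move=> hf hg; exact: is_deriveD. Qed.

Lemma is_derive1N f t df : is_derive t 1 f df ->
  is_derive t 1 (fun t => - f t) (- df).
Proof. by move=> hf; exact: is_deriveN. Qed.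

Lemma is_derive1V f t df : f t != 0 -> is_derive t 1 f df ->
  is_derive t 1 (fun t => (f t)^-1) (- (f t) ^- 2 * df).
Proof. by move=> f0 hf; exact: is_deriveV. Qed.

Lemma is_derive_expRN t : is_derive t 1 (fun t => expR (- t)) (- expR (- t)).
Proof.
have h : is_derive t 1 (-%R : R -> R) (- 1) by exact: is_deriveNid.
by have := is_derive1_comp (is_derive_expR (- t)) h; rewrite mulrN1.
Qed.

End Derivatives.

(** * The geodesic equation of the hyperbolic metric *)

Section Christoffel.
Variable R : realType.
Implicit Type q : 'rV[R]_4.

Lemma partial_hyp_metric i j l q : H4 q ->
  partial i (fun x => hyp_metric x j l) q =
  - 2 * (q 0 0) ^- 3 * (j == l)%:R * (i == 0)%:R.
Proof.
move=> q0; have qN0 : q 0 0 != 0 by rewrite gt_eqF.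
have -> : (fun x : 'rV[R]_4 => hyp_metric x j l) =
    (j == l)%:R \*o (fun x : 'rV[R]_4 => (x 0 0 ^+ 2)^-1).
  by apply/funext => x /=; rewrite mxE; case: eqP => _; rewrite ?mulr1n ?mul1r ?mulr0n ?mul0r.
have dc : differentiable (fun x : 'rV[R]_4 => x 0 0 ^+ 2) q.
  exact/(@differentiableX _ _ _ 1)/differentiable_coord.
have d1 : derivable (fun x : 'rV[R]_4 => x 0 0) q (delta_mx 0 i).
  exact/diff_derivable/differentiable_coord.
rewrite /partial deriveMl; last first.
  by apply: derivableV; [rewrite expf_neq0|exact: diff_derivable].
rewrite deriveV ?expf_neq0//; last exact: diff_derivable.
have -> : 'D_(delta_mx 0 i) (fun x : 'rV[R]_4 => x 0 0 ^+ 2) q = _ := deriveX 2 d1.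
have d : derivable (id : 'rV[R]_4 -> _) q (delta_mx 0 i) by exact: derivable_id.
have := derive_mx d; rewrite derive_id => /matrixP/(_ 0 0).
rewrite !mxE eqxx/= => <-; rewrite (eq_sym 0 i) /GRing.scale/=.
by field.
Qed.

(** The metric is a scalar matrix, so only the term $l=k$ survives, and the scalar depends on $p_0$
    alone. *)
Lemma christoffel_hyp_metric q k i j : H4 q ->
  christoffel (@hyp_metric R) q k i j =
  ((k == 0)%:R * (i == j)%:R - (i == 0)%:R * (k == j)%:R
   - (j == 0)%:R * (k == i)%:R) / q 0 0.
Proof.
move=> q0; have qN0 : q 0 0 != 0 by rewrite gt_eqF.
rewrite /christoffel (bigD1 k)//= big1 => [|l lk]; last first.
  by rewrite /hyp_metric invmx_scalar mxE eq_sym (negbTE lk) mulr0n mul0r.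
rewrite addr0 !partial_hyp_metric// /hyp_metric invmx_scalar mxE eqxx mulr1n.
rewrite (eq_sym j k) (eq_sym i k).
by field.
Qed.

Lemma geodesic_equation (c : R -> 'rV[R]_4) t k : H4 (c t) ->
  - \sum_(i < 4) \sum_(j < 4)
      christoffel (@hyp_metric R) (c t) k i j * derive1 c t 0 i * derive1 c t 0 j
  = (2 * derive1 c t 0 0 * derive1 c t 0 k -
     (k == 0)%:R * \sum_(i < 4) derive1 c t 0 i ^+ 2) / c t 0 0.
Proof.
move=> ct0; have cN0 : c t 0 0 != 0 by rewrite gt_eqF.
(* Indexing the velocity by natural numbers makes different terms for the same ordinal agree, so
   that [field] sees the same atoms on both sides. *)
pose d m := derive1 c t 0 (inord m).
have dE i : derive1 c t 0 i = d i by rewrite /d inord_val.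
under eq_bigr => i _ do under eq_bigr => j _ do
  rewrite christoffel_hyp_metric// -!val_eqE/= !dE.
under [in RHS]eq_bigr => i _ do rewrite dE.
rewrite -val_eqE/= !dE.
rewrite !big_ord_recl !big_ord0/= /bump/=.
by case: k => -[|[|[|[|//]]]] k4 /=; field.
Qed.

End Christoffel.

(** * Hyperbolic functions *)

Section Hyperbolic.
Variable R : realType.
Implicit Type t : R.

Lemma is_derive1_mx m n (M : R -> 'M[R]_(m, n)) t dM :
  is_derive t 1 M dM <->
  forall i j, is_derive t 1 (fun t => M t i j) (dM i j).
Proof.
split=> [[d <-] i j|h].
  by split; [exact: (derivable_mxP M t 1).1 d i j|rewrite derive_mx// mxE].
have d : derivable M t 1 by apply/derivable_mxP => i j; case: (h i j).
split=> //; rewrite derive_mx//; apply/matrixP => i j; rewrite mxE.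
by case: (h i j).
Qed.

Lemma is_derive1_derive1 (V : normedModType R) (f : R -> V) t :
  derivable f t 1 -> is_derive t 1 f (derive1 f t).
Proof. by move=> d; rewrite derive1E; split. Qed.

Definition cosh (t : R) := (expR t + expR (- t)) / 2.
Definition sinh (t : R) := (expR t - expR (- t)) / 2.
Definition tanh (t : R) := sinh t / cosh t.

Lemma cosh_gt0 t : 0 < cosh t.
Proof. by rewrite divr_gt0// addr_gt0// expR_gt0. Qed.

Lemma cosh_neq0 t : cosh t != 0. Proof. by rewrite gt_eqF ?cosh_gt0. Qed.

Lemma cosh2Bsinh2 t : cosh t ^+ 2 - sinh t ^+ 2 = 1.
Proof.
have : expR t * expR (- t) = 1 by rewrite -expRD subrr expR0.
by rewrite /cosh /sinh => h; rewrite -[RHS]h; field.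
Qed.

Lemma cosh0 : cosh 0 = 1.
Proof. by rewrite /cosh oppr0 expR0; field. Qed.

Lemma sinh0 : sinh 0 = 0.
Proof. by rewrite /sinh oppr0 subrr mul0r. Qed.

Lemma tanh0 : tanh 0 = 0.
Proof. by rewrite /tanh sinh0 mul0r. Qed.

Lemma is_derive_cosh t : is_derive t 1 cosh (sinh t).
Proof.
have := is_derive1M (is_derive1D (is_derive_expR t) (is_derive_expRN t))
  (is_derive_cst (2^-1 : R) t 1).
by rewrite mulr0 add0r mulrC.
Qed.

Lemma is_derive_sinh t : is_derive t 1 sinh (cosh t).
Proof.
have := is_derive1M (is_derive1D (is_derive_expR t)
  (is_derive1N (is_derive_expRN t))) (is_derive_cst (2^-1 : R) t 1).
by rewrite mulr0 add0r opprK mulrC.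
Qed.

Lemma is_derive_sech t :
  is_derive t 1 (fun t => (cosh t)^-1) (- sinh t / cosh t ^+ 2).
Proof.
apply: is_derive_eq; first exact: (is_derive1V (cosh_neq0 t) (is_derive_cosh t)).
by rewrite mulrC mulNr mulrN.
Qed.

Lemma is_derive_tanh t : is_derive t 1 tanh (cosh t ^- 2).
Proof.
apply: is_derive_eq.
  exact: (is_derive1M (is_derive_sinh t) (is_derive_sech t)).
have c0 := cosh_neq0 t; rewrite -[RHS]mul1r -(cosh2Bsinh2 t).
by field.
Qed.

Lemma sech_tanh t : (cosh t)^-1 ^+ 2 + tanh t ^+ 2 = 1.
Proof.
have c0 := cosh_neq0 t; rewrite /tanh.
have -> : (cosh t)^-1 ^+ 2 + (sinh t / cosh t) ^+ 2 =
  (1 + sinh t ^+ 2) / cosh t ^+ 2 by field.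
by rewrite -[1 in X in X / _](cosh2Bsinh2 t) subrK divff ?expf_neq0.
Qed.

End Hyperbolic.

(** * Geodesics tangent to the horosphere *)

Section HorosphereCurve.
Variable R : realType.
Implicit Type t : R.

Lemma ord4P (k : 'I_4) : k = 0 \/ exists j : 'I_3, k = lift 0 j.
Proof. by case: (unliftP ord0 k) => [j ->|->]; [right; exists j|left]. Qed.

(* The implicit sizes of row_mxEl and row_mxEr do not unify with 4. *)
Lemma row4_mxE0 (a : R) (B : 'rV[R]_3) :
  (row_mx (a%:M : 'M[R]_1) B : 'rV[R]_4) 0 0 = a.
Proof.
have := @row_mxEl R 1 1 3 a%:M B 0 0; rewrite [RHS]mxE eqxx mulr1n => {2}<-.
by congr (fun_of_matrix _ _ _); exact: val_inj.
Qed.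

Lemma row4_mxES (A : 'M[R]_1) (B : 'rV[R]_3) j :
  (row_mx A B : 'rV[R]_4) 0 (lift 0 j) = B 0 j.
Proof. by rewrite -rshift1; exact: row_mxEr. Qed.

(** For a unit [w], this is the Euclidean half circle of radius 1 about $(0,p)$, traversed at
    hyperbolic unit speed from its top $(1,p)$. *)
Definition horo_curve (p w : 'rV[R]_3) (t : R) : 'rV[R]_4 :=
  row_mx (((cosh t)^-1)%:M : 'M[R]_1) (p + tanh t *: w).

Lemma horo_curve0 p w t : horo_curve p w t 0 0 = (cosh t)^-1.
Proof.
by exact: row4_mxE0.
Qed.

Lemma horo_curveS p w t j :
  horo_curve p w t 0 (lift 0 j) = p 0 j + tanh t * w 0 j.
Proof. by rewrite row4_mxES !mxE. Qed.

Variables p w : 'rV[R]_3.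
Hypothesis w1 : \sum_j w 0 j ^+ 2 = 1.

Let horo_curve' t : 'rV[R]_4 :=
  row_mx ((- sinh t / cosh t ^+ 2)%:M : 'M[R]_1) (cosh t ^- 2 *: w).

Let horo_curve'' t : 'rV[R]_4 :=
  row_mx (((sinh t ^+ 2 - 1) / cosh t ^+ 3)%:M : 'M[R]_1)
    ((- 2 * sinh t / cosh t ^+ 3) *: w).

Lemma is_derive_horo_curve t : is_derive t 1 (horo_curve p w) (horo_curve' t).
Proof.
apply/is_derive1_mx => i k; rewrite ord1; have [->|[j ->]] := ord4P k.
  under eq_fun do rewrite row4_mxE0.
  rewrite row4_mxE0; exact: is_derive_sech.
under eq_fun do rewrite row4_mxES !mxE.
rewrite row4_mxES !mxE.
apply: (is_derive_eq (is_derive1D (is_derive_cst _ _ _)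
  (is_derive1M (is_derive_tanh t) (is_derive_cst _ _ _)))).
by rewrite mulr0 !add0r mulrC.
Qed.

Lemma is_derive_horo_curve' t : is_derive t 1 horo_curve' (horo_curve'' t).
Proof.
have c0 := cosh_neq0 t.
have dc := is_derive1V c0 (is_derive_cosh t).
have dc2 : is_derive t 1 (fun t => cosh t ^- 2) (- 2 * sinh t / cosh t ^+ 3).
  rewrite (_ : (fun t => cosh t ^- 2) = (fun t => (cosh t)^-1 * (cosh t)^-1)).
    by apply: (is_derive_eq (is_derive1M dc dc)); field.
  by apply/funext => s; rewrite -invfM expr2.
apply/is_derive1_mx => i k; rewrite ord1; have [->|[j ->]] := ord4P k.
  under eq_fun do rewrite row4_mxE0.
  rewrite row4_mxE0.
  apply: (is_derive_eq (is_derive1M (is_derive1N (is_derive_sinh t)) dc2)).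
  have e : cosh t ^+ 2 = sinh t ^+ 2 + 1 by rewrite -(cosh2Bsinh2 t) subrKC.
  have -> : - sinh t * (- 2 * sinh t / cosh t ^+ 3) + cosh t ^- 2 * - cosh t =
    (2 * sinh t ^+ 2 - cosh t ^+ 2) / cosh t ^+ 3 by field.
  by rewrite e; field.
under eq_fun do rewrite row4_mxES !mxE.
rewrite row4_mxES !mxE.
apply: (is_derive_eq (is_derive1M dc2 (is_derive_cst _ _ _))).
by rewrite mulr0 add0r mulrC.
Qed.

Lemma horo_curve_geodesic : is_geodesic (@H4 R) (@hyp_metric R) (horo_curve p w).
Proof.
have d1 t : derive1 (horo_curve p w) t = horo_curve' t.
  by rewrite derive1E; apply: derive_val; exact: is_derive_horo_curve.
have d1E : derive1 (horo_curve p w) = horo_curve' by exact/funext.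
have H t : H4 (horo_curve p w t) by rewrite /H4/= horo_curve0 invr_gt0 cosh_gt0.
move=> t; split=> //.
- by case: (is_derive_horo_curve t).
- by rewrite d1E; case: (is_derive_horo_curve' t).
move=> k; rewrite geodesic_equation// d1E horo_curve0.
have -> : derive1 horo_curve' t = horo_curve'' t.
  by rewrite derive1E; apply: derive_val; exact: is_derive_horo_curve'.
have c0 := cosh_neq0 t.
have hc0 : horo_curve' t 0 0 = - sinh t / cosh t ^+ 2.
  exact: row4_mxE0.
rewrite hc0; have [->|[j ->]] := ord4P k.
  rewrite eqxx big_ord_recl hc0.
  under eq_bigr => i _ do rewrite row4_mxES mxE exprMn.
  rewrite -mulr_sumr w1 row4_mxE0 mulr1 mul1r.
  by field.
rewrite mul0r subr0 !row4_mxES !mxE.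
by field.
Qed.

Lemma horo_curve_at0 : horo_curve p w 0 = horo_point p.
Proof.
by rewrite /horo_curve tanh0 scale0r addr0 cosh0 invr1.
Qed.

Lemma derive1_horo_curve_at0 : derive1 (horo_curve p w) 0 = horo_vector w.
Proof.
rewrite derive1E (@derive_val _ _ _ _ _ _ _ (is_derive_horo_curve 0)).
by rewrite /horo_curve' sinh0 cosh0 oppr0 mul0r expr1n invr1 scale1r raddf0.
Qed.

Section Uniqueness.
Variable c : R -> 'rV[R]_4.
Hypotheses (geoc : is_geodesic (@H4 R) (@hyp_metric R) c)
  (c0 : c 0 = horo_point p) (c'0 : derive1 c 0 = horo_vector w).

Let y t : R := c t 0 0.
Let dy t : R := derive1 c t 0 0.

Let y_gt0 t : 0 < y t. Proof. by have [] := geoc t. Qed.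

Let y_neq0 t : y t != 0. Proof. by rewrite gt_eqF ?y_gt0. Qed.

Let is_derive_c k t : is_derive t 1 (fun t => c t 0 k) (derive1 c t 0 k).
Proof.
have [_ d _ _] := geoc t.
by have := (is_derive1_mx c t _).1 (is_derive1_derive1 d); apply.
Qed.

Let is_derive_dc k t : is_derive t 1 (fun t => derive1 c t 0 k)
  ((2 * dy t * derive1 c t 0 k -
     (k == 0)%:R * \sum_(i < 4) derive1 c t 0 i ^+ 2) / y t).
Proof.
have [H _ d e] := geoc t; rewrite -geodesic_equation// -e.
by have := (is_derive1_mx _ t _).1 (is_derive1_derive1 d); apply.
Qed.

Let is_derive_Vy2 t : is_derive t 1 (fun t => (y t)^-1 * (y t)^-1)
  (- 2 * dy t / y t ^+ 3).
Proof.
have dV : is_derive t 1 (fun t => (y t)^-1) (- (y t) ^- 2 * dy t).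
  exact: (is_derive1V (y_neq0 t) (is_derive_c 0 t)).
have yN0 := y_neq0 t.
by apply: (is_derive_eq (is_derive1M dV dV)); field.
Qed.

Let y0 : y 0 = 1. Proof. by rewrite /y c0; exact: row4_mxE0. Qed.

Let dy0 : dy 0 = 0.
Proof.
have e : (0 : 'M[R]_1) = 0%:M by rewrite raddf0.
by rewrite /dy c'0 /horo_vector e row4_mxE0.
Qed.

(** Horizontal translations are isometries, so the momenta $c_j'/c_0^2$ are conserved; at $t=0$ they
    equal $w_j$. *)
Let dcS t j : derive1 c t 0 (lift 0 j) = y t ^+ 2 * w 0 j.
Proof.
suff : derive1 c t 0 (lift 0 j) * ((y t)^-1 * (y t)^-1) = w 0 j.
  by move=> <-; field; exact: y_neq0.
have -> : w 0 j = derive1 c 0 0 (lift 0 j) * ((y 0)^-1 * (y 0)^-1).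
  by rewrite y0 invr1 !mulr1 c'0; symmetry; exact: row4_mxES.
apply: (@is_derive_0_is_cst _
  (fun t => derive1 c t 0 (lift 0 j) * ((y t)^-1 * (y t)^-1))) => s.
apply: (is_derive_eq (is_derive1M (is_derive_dc _ s) (is_derive_Vy2 s))).
by rewrite mul0r subr0; field; exact: y_neq0.
Qed.

Let is_derive_dy t : is_derive t 1 dy ((dy t ^+ 2 - y t ^+ 4) / y t).
Proof.
apply: (is_derive_eq (is_derive_dc 0 t)).
rewrite eqxx mul1r big_ord_recl.
under eq_bigr => i _ do rewrite dcS exprMn.
rewrite -mulr_sumr w1 mulr1 -[derive1 c t 0 ord0]/(dy t).
by field; exact: y_neq0.
Qed.

(* The kinetic energy (dy ^+ 2 + y ^+ 4) / y ^+ 2 is constant. *)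
Let energy t : dy t ^+ 2 = y t ^+ 2 - y t ^+ 4.
Proof.
pose E s := dy s * dy s * ((y s)^-1 * (y s)^-1) + y s * y s.
suff : E t = E 0.
  rewrite /E y0 dy0 mul0r mul0r add0r mulr1 => /(congr1 (fun x => y t ^+ 2 * x)).
  by rewrite mulr1 => <-; field; exact: y_neq0.
apply: is_derive_0_is_cst => s.
have d := is_derive_dy s.
have dc : is_derive s 1 y (dy s) by exact: is_derive_c.
apply: (is_derive_eq (is_derive1D
  (is_derive1M (is_derive1M d d) (is_derive_Vy2 s)) (is_derive1M dc dc))).
by field; exact: y_neq0.
Qed.

(* Hence a = y^-1 solves a'' = a. *)
Let yE t : y t = (cosh t)^-1.
Proof.
pose a s : R := (y s)^-1; pose b s : R := - dy s * ((y s)^-1 * (y s)^-1).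
have da (s : R) : is_derive s 1 a (b s).
  have dy' : is_derive s 1 y (dy s) by exact: is_derive_c.
  apply: (is_derive_eq (is_derive1V (y_neq0 s) dy')).
  by rewrite /b; field; exact: y_neq0.
have db (s : R) : is_derive s 1 b (a s).
  apply: (is_derive_eq (is_derive1M (is_derive1N (is_derive_dy s))
    (is_derive_Vy2 s))).
  have -> : - dy s * (- 2 * dy s / y s ^+ 3) +
     (y s)^-1 * (y s)^-1 * - ((dy s ^+ 2 - y s ^+ 4) / y s) =
     (dy s ^+ 2 + y s ^+ 4) / y s ^+ 3 by field; exact: y_neq0.
  by rewrite energy /a; field; exact: y_neq0.
have b0 : b 0 = 0 by rewrite /b dy0 oppr0 mul0r.
have a0 : a 0 = 1 by rewrite /a y0 invr1.
(* Since $a'=b$ and $b'=a$, both $(a+b)e^{-t}$ and $(a-b)e^{t}$ have derivative zero. *)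
have e1 : (a t + b t) * expR (- t) = 1.
  have -> : 1 = (a 0 + b 0) * expR (- 0) by rewrite a0 b0 oppr0 expR0 addr0 mulr1.
  apply: (@is_derive_0_is_cst _ (fun t => (a t + b t) * expR (- t))) => s.
  apply: (is_derive_eq (is_derive1M (is_derive1D (da s) (db s))
    (is_derive_expRN s))).
  by ring.
have e2 : (a t - b t) * expR t = 1.
  have -> : 1 = (a 0 - b 0) * expR 0 by rewrite a0 b0 expR0 subr0 mulr1.
  apply: (@is_derive_0_is_cst _ (fun t => (a t - b t) * expR t)) => s.
  apply: (is_derive_eq (is_derive1M (is_derive1D (da s) (is_derive1N (db s)))
    (is_derive_expR s))).
  by ring.
have ee : expR t * expR (- t) = 1 by rewrite -expRD subrr expR0.
have eP : a t + b t = expR t by rewrite -[LHS]mulr1 -ee mulrCA e1 mulr1.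
have eN : a t - b t = expR (- t).
  by rewrite -[LHS]mulr1 -ee mulrA e2 mul1r.
rewrite -[LHS]invrK; congr (_^-1).
by rewrite /cosh -eP -eN /a; field; exact: y_neq0.
Qed.

(** With the height known, [dcS] says $c_j'=w_j/\cosh^2t$, which is the derivative of $w_j\tanh
    t$. *)
Lemma horo_curve_unique : c = horo_curve p w.
Proof.
apply/funext => t; apply/rowP => k; have [->|[j ->]] := ord4P k.
  by rewrite horo_curve0 -yE.
rewrite horo_curveS; apply/eqP; rewrite -subr_eq; apply/eqP.
have -> : p 0 j = c 0 0 (lift 0 j) - tanh 0 * w 0 j.
  rewrite c0 -horo_curve_at0 horo_curveS addrK //.
apply: (@is_derive_0_is_cst _
  (fun t => c t 0 (lift 0 j) - tanh t * w 0 j)) => s.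
apply: (is_derive_eq (is_derive1D (is_derive_c _ s)
  (is_derive1N (is_derive1M (is_derive_tanh s) (is_derive_cst _ _ _))))).
by rewrite dcS mulr0 add0r yE -exprVn mulrC subrr.
Qed.

End Uniqueness.

(** As [geodesic] is a choice among solutions, uniqueness is what identifies it with the half
    circle. *)
Lemma geodesic_horo :
  geodesic (@H4 R) (@hyp_metric R) (horo_point p) (horo_vector w) =
  horo_curve p w.
Proof.
apply: xget_unique => [|c [gc c0 c'0]]; last exact: horo_curve_unique.
split; [exact: horo_curve_geodesic|exact: horo_curve_at0|].
exact: derive1_horo_curve_at0.
Qed.

End HorosphereCurve.

(** * Inverting displacement along the Hopf field *)

Section HopfField.
Variable R : realType.
Implicit Types (s : R) (p q : 'rV[R]_3).

Lemma pt3E0 (x y z : R) : pt3 x y z 0 0 = x. Proof. by rewrite mxE. Qed.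
Lemma pt3E1 (x y z : R) : pt3 x y z 0 1 = y. Proof. by rewrite mxE. Qed.
Lemma pt3E2 (x y z : R) : pt3 x y z 0 2%:R = z. Proof. by rewrite mxE. Qed.
Definition pt3E := (pt3E0, pt3E1, pt3E2).

Lemma ord3P (P : 'I_3 -> Prop) : P 0 -> P 1 -> P 2%:R -> forall j, P j.
Proof.
by move=> P0 P1 P2 -[[|[|[|//]]] j3];
  [move: P0|move: P1|move: P2]; congr P; exact: val_inj.
Qed.

Lemma pt3_eta p : p = pt3 (p 0 0) (p 0 1) (p 0 2%:R).
Proof. by apply/rowP; apply: ord3P; rewrite pt3E. Qed.

Lemma sum3 (F : 'I_3 -> R) : \sum_j F j = F 0 + F 1 + F 2%:R.
Proof.
rewrite !big_ord_recl big_ord0 addr0 addrA.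
by congr (F _ + F _ + F _); exact: val_inj.
Qed.

Lemma gt0_1Dsqr (x : R) : 0 < 1 + x ^+ 2.
Proof. by rewrite ltr_wpDr ?sqr_ge0. Qed.

Lemma neq0_1Dsqr (x : R) : 1 + x ^+ 2 != 0.
Proof. by rewrite gt_eqF ?gt0_1Dsqr. Qed.

Lemma neq0_1Dsqr3 (x y z : R) : 1 + x ^+ 2 + y ^+ 2 + z ^+ 2 != 0.
Proof. by rewrite gt_eqF// !ltr_wpDr ?sqr_ge0. Qed.

Lemma neq0_sqr3D1 (x y z : R) : x ^+ 2 + y ^+ 2 + z ^+ 2 + 1 != 0.
Proof. by rewrite gt_eqF// ltr_wpDl// !addr_ge0 ?sqr_ge0. Qed.

Lemma hopf_field_unit p : \sum_j hopf_field p 0 j ^+ 2 = 1.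
Proof.
rewrite sum3 /hopf_field; have := neq0_sqr3D1 (p 0 0) (p 0 1) (p 0 2%:R).
move: (p 0 0) (p 0 1) (p 0 2%:R) => x y z d0.
by rewrite ![(_ *: pt3 _ _ _) 0 _]mxE !pt3E; field.
Qed.

Definition hopf_push s p := p + s *: hopf_field p.

(** The inverse of [hopf_push]: with $w'=q_1+iq_2$, the last two coordinates are those of
    $w'(1-ix)/(1-iX)$. *)
Definition hopf_pull s q :=
  let X := q 0 0 + s in
  let S := 1 + X ^+ 2 in
  let x := X - 2 * s * S / (S + q 0 1 ^+ 2 + q 0 2%:R ^+ 2) in
  pt3 x ((q 0 1 * (1 + x * X) - q 0 2%:R * (X - x)) / S)
        ((q 0 2%:R * (1 + x * X) + q 0 1 * (X - x)) / S).

(* With w = y + i z and X = x + m, this is (x, w) |-> *)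
(* (X - s, w (1 - i X) / (1 - i x)), whose inverse is explicit.  *)
Lemma hopf_pushE s x y z :
  let m := 2 * s * (1 + x ^+ 2) / (1 + x ^+ 2 + y ^+ 2 + z ^+ 2) in
  hopf_push s (pt3 x y z) =
  pt3 (x + m - s) ((y * (1 + x * (x + m)) + z * m) / (1 + x ^+ 2))
    ((z * (1 + x * (x + m)) - y * m) / (1 + x ^+ 2)).
Proof.
move=> m; rewrite /m; have d0 := neq0_1Dsqr3 x y z; have d1 := neq0_sqr3D1 x y z.
have x0 := neq0_1Dsqr x.
apply/rowP; apply: ord3P; rewrite /hopf_push /hopf_field !mxE/=; rewrite ?pt3E.
- by field; rewrite ?x0 ?d0 ?d1.
- by field; rewrite ?x0 ?d0 ?d1.
- by field; rewrite ?x0 ?d0 ?d1.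
Qed.

Lemma hopf_pushK s : cancel (hopf_push s) (hopf_pull s).
Proof.
move=> p; rewrite [p]pt3_eta; move: (p 0 0) (p 0 1) (p 0 2%:R) => x y z.
rewrite hopf_pushE; have d0 := neq0_1Dsqr3 x y z; have x0 := neq0_1Dsqr x.
set d := 1 + x ^+ 2 + y ^+ 2 + z ^+ 2 in d0 *.
set m := 2 * s * (1 + x ^+ 2) / d.
rewrite /hopf_pull !pt3E subrK.
have X0 := neq0_1Dsqr (x + m).
(* Invariance of $\rho$: multiplication by $(1-iX)/(1-ix)$, with $X=x+m$, scales $|w|^2$ by
   $(1+X^2)/(1+x^2)$. The correction subtracted by [hopf_pull] is therefore again $m$. *)
have -> : 1 + (x + m) ^+ 2 +
    ((y * (1 + x * (x + m)) + z * m) / (1 + x ^+ 2)) ^+ 2 +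
    ((z * (1 + x * (x + m)) - y * m) / (1 + x ^+ 2)) ^+ 2 =
    (1 + (x + m) ^+ 2) * d / (1 + x ^+ 2).
  by rewrite /d; field.
have -> : x + m - 2 * s * (1 + (x + m) ^+ 2) /
    ((1 + (x + m) ^+ 2) * d / (1 + x ^+ 2)) = x.
  by rewrite {1}/m; field; rewrite ?x0 ?d0 ?X0 ?T0.
by congr pt3; field; rewrite ?x0 ?d0 ?X0 ?T0.
Qed.

Lemma hopf_pullK s : cancel (hopf_pull s) (hopf_push s).
Proof.
move=> q; rewrite [q]pt3_eta; move: (q 0 0) (q 0 1) (q 0 2%:R) => a b c.
rewrite /hopf_pull !pt3E; set X := a + s.
have X0 := neq0_1Dsqr X.
have T0 : 1 + X ^+ 2 + b ^+ 2 + c ^+ 2 != 0 by exact: neq0_1Dsqr3.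
set T := 1 + X ^+ 2 + b ^+ 2 + c ^+ 2 in T0 *.
set x := X - 2 * s * (1 + X ^+ 2) / T; have x0 := neq0_1Dsqr x.
have aE : a = X - s by rewrite /X addrK.
rewrite hopf_pushE.
have -> : 2 * s * (1 + x ^+ 2) / (1 + x ^+ 2 +
    ((b * (1 + x * X) - c * (X - x)) / (1 + X ^+ 2)) ^+ 2 +
    ((c * (1 + x * X) + b * (X - x)) / (1 + X ^+ 2)) ^+ 2) = X - x.
  have -> : 1 + x ^+ 2 +
    ((b * (1 + x * X) - c * (X - x)) / (1 + X ^+ 2)) ^+ 2 +
    ((c * (1 + x * X) + b * (X - x)) / (1 + X ^+ 2)) ^+ 2 =
    (1 + x ^+ 2) * T / (1 + X ^+ 2) by rewrite /T; field.
  have -> : X - x = 2 * s * (1 + X ^+ 2) / T by rewrite /x opprB subrKC.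
  by field; rewrite ?x0 ?d0 ?X0 ?T0.
by rewrite aE subrKC; congr pt3; field; rewrite ?x0 ?d0 ?X0 ?T0.
Qed.

End HopfField.

(** * The global chart and the foliations *)

Section StraighteningChart.
Variable R : realType.
Implicit Types (e t h : R) (p : 'rV[R]_3) (q : 'rV[R]_4).

Lemma sinh_gt0 t : 0 < t -> 0 < sinh t.
Proof.
by move=> t0; rewrite divr_gt0// subr_gt0 ltr_expR gtrN.
Qed.

Lemma tanh_gt0 t : 0 < t -> 0 < tanh t.
Proof. by move=> t0; rewrite divr_gt0 ?cosh_gt0 ?sinh_gt0. Qed.

Lemma coshN t : cosh (- t) = cosh t.
Proof. by rewrite /cosh opprK addrC. Qed.

Lemma tanhN t : tanh (- t) = - tanh t.
Proof. by rewrite /tanh coshN /sinh opprK -mulNr -mulNr opprB. Qed.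

Lemma tanhE t : 0 < t -> tanh t = Num.sqrt (1 - (cosh t)^-1 ^+ 2).
Proof.
move=> t0; rewrite -(sech_tanh t) addrAC subrr add0r sqrtr_sqr.
by rewrite ger0_norm// ltW// tanh_gt0.
Qed.

Lemma sech_itv t : 0 < t -> 0 < (cosh t)^-1 < 1.
Proof.
move=> t0; rewrite invr_gt0 cosh_gt0/= invf_lt1 ?cosh_gt0//.
rewrite -(ltr_pXn2r (ltn0Sn 1)) ?nnegrE ?ler01 ?(ltW (cosh_gt0 _))//.
by rewrite expr1n -subr_gt0 -(cosh2Bsinh2 t) subKr exprn_gt0// sinh_gt0.
Qed.

Lemma sech_surj h : 0 < h < 1 -> exists2 t, 0 < t & (cosh t)^-1 = h.
Proof.
move=> /andP[h0 h1]; set s := Num.sqrt (1 - h ^+ 2).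
have s0 : 0 <= s by exact: sqrtr_ge0.
have s2 : s ^+ 2 = 1 - h ^+ 2.
  by rewrite sqr_sqrtr// subr_ge0 expr_le1// ltW.
have hN0 : h != 0 by rewrite gt_eqF.
have s1N0 : 1 + s != 0 by rewrite gt_eqF// ltr_wpDr.
have g0 : 0 < (1 + s) / h by rewrite divr_gt0// ltr_wpDr.
(* If $e^t=(1+s)/h$ then $e^{-t}=(1-s)/h$, because $h^2=(1+s)(1-s)$; the mean of the two is
   $1/h$. *)
exists (ln ((1 + s) / h)).
  rewrite ln_gt0// ltr_pdivlMr// mul1r (lt_le_trans h1)//.
  by rewrite lerDl.
rewrite /cosh expRN lnK ?posrE//.
have -> : ((1 + s) / h)^-1 = (1 - s) / h.
  have e : h ^+ 2 = (1 + s) * (1 - s) 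
    by transitivity (1 - s ^+ 2); [rewrite s2 subKr|ring].
  have -> : (1 - s) / h = (1 + s) * (1 - s) / (h * (1 + s)).
    by field; rewrite ?hN0 ?s1N0.
  by rewrite -e; field; rewrite ?hN0 ?s1N0.
by rewrite -[RHS]invrK; congr (_^-1); field.
Qed.

Definition tail4 q : 'rV[R]_3 := \row_j q 0 (lift 0 j).

Definition cons4 (a : R) p : 'rV[R]_4 := row_mx (a%:M : 'M[R]_1) p.

Lemma cons4E0 a p : cons4 a p 0 0 = a. Proof. exact: row4_mxE0. Qed.

Lemma cons4K a p : tail4 (cons4 a p) = p.
Proof. by apply/rowP => j; rewrite mxE row4_mxES. Qed.

Lemma cons4_eta q : cons4 (q 0 0) (tail4 q) = q.
Proof.
apply/rowP => k; have [->|[j ->]] := ord4P k; first exact: row4_mxE0.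
by rewrite row4_mxES mxE.
Qed.

Lemma lower_cons4 a p : lower (cons4 a p) = (0 < a < 1) :> Prop.
Proof. by rewrite /lower/= cons4E0. Qed.

(* In the coordinates [straighten e], the rays with initial velocity *)
(* [e *: hopf_field p] are the verticals over the points [p]. *)
Definition unstraighten e q :=
  cons4 (q 0 0) (hopf_push (e * Num.sqrt (1 - q 0 0 ^+ 2)) (tail4 q)).

Definition straighten e q :=
  cons4 (q 0 0) (hopf_pull (e * Num.sqrt (1 - q 0 0 ^+ 2)) (tail4 q)).

Lemma unstraightenK e : cancel (unstraighten e) (straighten e).
Proof.
by move=> q; rewrite /straighten /unstraighten cons4E0 cons4K hopf_pushK cons4_eta.
Qed.

Lemma straightenK e : cancel (straighten e) (unstraighten e).
Proof.
by move=> q; rewrite /straighten /unstraighten cons4E0 cons4K hopf_pullK cons4_eta.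
Qed.

Lemma lower_straighten e q : lower q -> lower (straighten e q).
Proof. by rewrite /straighten lower_cons4. Qed.

Lemma lower_unstraighten e q : lower q -> lower (unstraighten e q).
Proof. by rewrite /unstraighten lower_cons4. Qed.

Lemma horo_curve_unstraighten e p t : 0 < t ->
  horo_curve p (e *: hopf_field p) t = unstraighten e (cons4 (cosh t)^-1 p).
Proof.
move=> t0; rewrite /unstraighten cons4E0 cons4K -tanhE// /hopf_push.
by rewrite /horo_curve scalerA mulrC.
Qed.

Lemma horo_geodesicE e p : e ^+ 2 = 1 ->
  horo_geodesic (fun p => e *: hopf_field p) p = horo_curve p (e *: hopf_field p).
Proof.
move=> e2; apply: geodesic_horo; under eq_bigr do rewrite mxE exprMn e2 mul1r.
exact: hopf_field_unit.
Qed.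

(** Since $\operatorname{sech}$ maps $(0,\infty)$ onto $(0,1)$, a ray is a whole fibre of the last
    three straightened coordinates. Covering and disjointness of the leaves follow at once. *)
Lemma horo_rayE e p : e ^+ 2 = 1 ->
  horo_geodesic (fun p => e *: hopf_field p) p @` [set t | 0 < t] =
  [set q | lower q /\ tail4 (straighten e q) = p].
Proof.
move=> e2; rewrite horo_geodesicE//; apply/seteqP; split=> [_ [t t0 <-]|q [Uq <-]].
  rewrite horo_curve_unstraighten//; split; last by rewrite unstraightenK cons4K.
  by apply: lower_unstraighten; rewrite lower_cons4 sech_itv.
have [t t0 te] := sech_surj Uq; exists t => //.
rewrite horo_curve_unstraighten// te -[RHS](straightenK e); congr unstraighten.
by rewrite -[RHS]cons4_eta {2}/straighten cons4E0.
Qed.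

Lemma open_lower : open (@lower R).
Proof.
have c : continuous (fun q => q 0 0) by exact: coord_continuous.
have -> : @lower R = (fun q => q 0 0) @^-1` `]0, 1[.
  by apply/seteqP; split=> q; rewrite /lower/= in_itv.
by apply: open_comp => [q _|]; [exact: c|exact: itv_open].
Qed.

Lemma open_box_lower : open_box (@lower R).
Proof.
exists (fun i => if i == 0 then `]0, 1[%classic else setT); split.
  move=> i; case: eqP => _; last by split; [exact: openT|].
  by split; [exact: itv_open|exact: interval_is_interval].
apply/seteqP; split=> [q Uq i|q /(_ 0)] /=; last by rewrite in_itv.
by have [->|[j ->]] := ord4P i; rewrite //= in_itv.
Qed.

Local Ltac elementary := repeat first
  [ exact: elementary_coord | exact: elementary_cst | assumption
  | apply: elementary_opp | apply: elementary_exp | apply: elementary_add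
  | apply: elementary_mul | apply: elementary_inv ].

(** Heights in [lower] stay strictly below 1, so the radicand is positive and the root is smooth. *)
Lemma elementary_height e : elementary (@lower R)
  (fun q => e * Num.sqrt (1 - q 0 0 ^+ 2)).
Proof.
elementary; apply: elementary_sqrt; last by elementary.
by move=> q /andP[q0 q1]; rewrite subr_gt0 expr_lt1// ltW.
Qed.

Lemma smooth_straighten e : smooth_map_on (@lower R) (straighten e).
Proof.
have eh := elementary_height e.
move=> k; apply: (elementary_smooth open_lower).
have [->|[j ->]] := ord4P k.
  by under eq_fun do rewrite cons4E0; elementary.
under eq_fun do rewrite row4_mxES.
move: j; apply: ord3P; under eq_fun do rewrite /hopf_pull pt3E ![tail4 _ 0 _]mxE.
- elementary => q _; exact: neq0_1Dsqr3.
- by elementary => q _; first [exact: neq0_1Dsqr3|exact: neq0_1Dsqr].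
- by elementary => q _; first [exact: neq0_1Dsqr3|exact: neq0_1Dsqr].
Qed.

Lemma smooth_unstraighten e : smooth_map_on (@lower R) (unstraighten e).
Proof.
have eh := elementary_height e.
move=> k; apply: (elementary_smooth open_lower).
have [->|[j ->]] := ord4P k.
  by under eq_fun do rewrite cons4E0; elementary.
under eq_fun do rewrite row4_mxES 3!mxE.
apply: elementary_add; first exact: elementary_coord.
apply: elementary_mul => //.
move: j; apply: ord3P; under eq_fun do rewrite /hopf_field mxE pt3E ![tail4 _ 0 _]mxE;
  by elementary => q _; exact: neq0_sqr3D1.
Qed.

Lemma diffeo_straighten e :
  diffeo_on (@lower R) (@lower R) (straighten e).
Proof.
split; [exact: open_lower|exact: open_lower|exact: smooth_straighten|].
exists (unstraighten e); split; first exact: smooth_unstraighten.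
  by move=> q Uq; rewrite straightenK; split=> //; exact: lower_straighten.
by move=> q Uq; rewrite unstraightenK; split=> //; exact: lower_unstraighten.
Qed.

Lemma continuous_horo_curve p w : continuous (horo_curve p w).
Proof.
move=> t; have [d _] := is_derive_horo_curve p w t.
exact/differentiable_continuous/derivable1_diffP.
Qed.

(** One chart, defined on all of [lower], serves every point; each leaf is connected, so its trace
    has a single component, the leaf itself. *)
Lemma foliation_horo_rays e : e ^+ 2 = 1 ->
  smooth_foliation 1 (@lower R) (horo_rays (fun p => e *: hopf_field p)).
Proof.
move=> e2; split.
- move=> _ [p _ <-]; split.
  + by exists (horo_geodesic (fun p => e *: hopf_field p) p 1); exists 1 => /=.
  + by rewrite horo_rayE// => q [].
  + move=> _ _ [t t0 <-] [u u0 <-].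
    rewrite horo_geodesicE//; set g := horo_curve _ _.
    exists (fun x => g (t + x * (u - t))); split.
    * have ca : continuous (fun x : R => t + x * (u - t)).
        move=> x; apply: cvgD; first exact: cvg_cst.
        by apply: cvgM; [exact: cvg_id|exact: cvg_cst].
      have : continuous (g \o (fun x : R => t + x * (u - t))).
        move=> x; apply: continuous_comp; first exact: ca.
        exact: continuous_horo_curve.
      exact: continuous_subspaceT.
    * by rewrite mul0r addr0.
    * by rewrite mul1r subrKC.
    * move=> x /andP[x0 x1]; exists (t + x * (u - t)) => //=.
      have -> : t + x * (u - t) = (1 - x) * t + x * u by ring.
      move: x0; rewrite le_eqVlt => /predU1P[<-|x0].
        by rewrite subr0 mul1r mul0r addr0.
      by rewrite ltr_wpDl ?mulr_gt0// mulr_ge0 ?subr_ge0// ltW.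
- move=> q Uq; exists (horo_geodesic (fun p => e *: hopf_field p)
    (tail4 (straighten e q)) @` [set t | 0 < t]).
    by exists (tail4 (straighten e q)).
  by rewrite horo_rayE.
- move=> _ _ [p _ <-] [p' _ <-]; rewrite !horo_rayE//.
  by move=> [q [[_ qp] [_ qp']]]; rewrite -qp -qp'.
- move=> q Uq; exists (@lower R), (@lower R), (straighten e).
  split=> //; [exact: open_box_lower|exact: diffeo_straighten|].
  move=> _ [p _ <-] y [].
  have sub : horo_geodesic (fun p => e *: hopf_field p) p @` [set t | 0 < t] `<=`
    @lower R by rewrite horo_rayE// => z [].
  rewrite setIidl// => Ly Uy; rewrite connected_component_id//; last first.
    rewrite horo_geodesicE//; apply: connected_continuous_connected.
      apply/connected_intervalP => a b /= a0 _ z /andP[az _].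
      exact: lt_le_trans az.
    exact/continuous_subspaceT/continuous_horo_curve.
  move: Ly; rewrite horo_rayE// => -[_ <-].
  apply/seteqP; split=> [z [Uz zy]|z [Uz zy]]; split=> //.
    move=> i; have [->//|[j ->] _] := ord4P i.
    by have /rowP/(_ j) := zy; rewrite !mxE.
  by apply/rowP => j; rewrite mxE [RHS]mxE zy.
Qed.

End StraighteningChart.

(** * Angles with a multiple in $2\pi\mathbb{Z}$ *)

Section CosineEqualsOne.
Variable R : realType.

Lemma cosDz2pi (x : R) (k : int) : cos (x + k%:~R * (pi *+ 2)) = cos x.
Proof.
rewrite mulrzl; case: k => n.
  by rewrite -pmulrn; exact: (periodicn (@cosD2pi R)).
rewrite NegzE mulrNz -pmulrn.
by have := periodicn (@cosD2pi R) n.+1 (x - pi *+ 2 *+ n.+1); rewrite subrK.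
Qed.

(** Reduce modulo $2\pi$ and halve, to get $y\in[0,\pi)$; then $\cos 2y=1-2\sin^2y$ forces $\sin
    y=0$, so $y=0$. *)
Lemma cos_eq1P (x : R) : cos x = 1 <-> exists k : int, x = k%:~R * (pi *+ 2).
Proof.
split=> [c1|[k ->]]; last by rewrite -[_ * _]add0r cosDz2pi cos0.
have p0 : 0 < pi *+ 2 :> R by rewrite mulrn_wgt0// pi_gt0.
exists (Num.floor (x / (pi *+ 2))); set k := Num.floor _.
have /andP[k1 k2] := floor_itv (x / (pi *+ 2)).
rewrite ler_pdivlMr// -/k in k1; rewrite ltr_pdivrMr// -/k intrD mulrDl mul1r in k2.
set y := (x - k%:~R * (pi *+ 2)) / 2.
have xE : x = y *+ 2 + k%:~R * (pi *+ 2).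
  by rewrite -mulr_natr /y divfK ?subrK.
have y0 : 0 <= y by rewrite divr_ge0// subr_ge0.
have ypi : y < pi by rewrite ltr_pdivrMr// ltrBlDl mulr_natr.
have sy : sin y = 0.
  move: c1; rewrite xE cosDz2pi cos_mulr2n cos2sin2 => c1; apply/eqP.
  rewrite -sqrf_eq0; apply/eqP; move: c1; set a := sin y ^+ 2 => c1; lra.
move: y0; rewrite le_eqVlt => /predU1P[y0|y0].
  by rewrite [LHS]xE -y0 mul0rn add0r.
by have := @sin_gt0_pi R y; rewrite y0 ypi sy ltxx => /(_ isT).
Qed.

Lemma mulrn_2pi (theta : R) :
  (exists2 n, (0 < n)%N & cos (theta *+ n) = 1) <->
  (exists r : rat, theta = ratr r * pi).
Proof.
split=> [[n n0 /cos_eq1P[k e]]|[r ->]].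
  exists ((k *+ 2)%:~R / n%:~R); have nN0 : n%:R != 0 :> R by rewrite pnatr_eq0 -lt0n.
  rewrite fmorph_div/= !ratr_int -pmulrn rmorphMn/=.
  apply: (mulIf nN0); rewrite mulr_natr e -mulr_natr.
  by field.
(* If $\theta=(a/d)\pi$ then $2d\,\theta=a\cdot2\pi$. *)
exists (`|denq r| * 2)%N; first by rewrite muln_gt0 absz_gt0 denq_neq0.
apply/cos_eq1P; exists (numq r).
rewrite -[LHS]mulr_natr -[pi *+ 2]mulr_natr natrM.
have dE : `|denq r|%N%:R = (denq r)%:~R :> R by rewrite pmulrn gtz0_abs ?denq_gt0.
have dN0 : (denq r)%:~R != 0 :> R by rewrite intr_eq0 denq_neq0.
by rewrite dE /ratr; field.
Qed.

End CosineEqualsOne.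

(** * The outer billiard map and its invariant sets *)

Section OuterBilliard.
Variable R : realType.
Implicit Types (h x y z : R) (p : 'rV[R]_3) (q : 'rV[R]_4).

(** The rays of $-v$ are the backward halves of the geodesics of $v$: find the foot point along the
    backward half, then go to the same height on the forward half. *)
Definition billiard q := unstraighten 1 (straighten (-1) q).

Definition billiard_inv q := unstraighten (-1) (straighten 1 q).

Lemma billiardK : cancel billiard billiard_inv.
Proof. by move=> q; rewrite /billiard_inv unstraightenK straightenK. Qed.

Lemma billiard_invK : cancel billiard_inv billiard.
Proof. by move=> q; rewrite /billiard unstraightenK straightenK. Qed.

Lemma lower_billiard q : lower q -> lower (billiard q).
Proof. by move=> Uq; apply/lower_unstraighten/lower_straighten. Qed.

Lemma lower_billiard_inv q : lower q -> lower (billiard_inv q).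
Proof. by move=> Uq; apply/lower_unstraighten/lower_straighten. Qed.

Lemma set_bij_billiard : set_bij (@lower R) (@lower R) billiard.
Proof.
split=> [q|q q' _ _|q Uq]; first exact: lower_billiard.
  exact: (can_inj billiardK).
by exists (billiard_inv q); [exact: lower_billiard_inv|exact: billiard_invK].
Qed.

Lemma horo_geodesic_billiard p t : 0 < t ->
  horo_geodesic (@hopf_field R) p t = unstraighten 1 (cons4 (cosh t)^-1 p) /\
  horo_geodesic (@hopf_field R) p (- t) = unstraighten (-1) (cons4 (cosh t)^-1 p).
Proof.
move=> t0; have v1 : @hopf_field R = fun p => 1 *: hopf_field p.
  by apply/funext => q; rewrite scale1r.
rewrite [in LHS]v1 [in X in _ /\ X = _]v1 horo_geodesicE ?expr1n//.
rewrite -!horo_curve_unstraighten//; split=> //.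
by rewrite /horo_curve coshN tanhN scale1r scaleN1r scalerN scaleNr.
Qed.

(** Each point of [lower] is $\gamma_{v(p)}(-t)$ for some $p$ and $t>0$, so the defining relation
    determines [B] there. *)
Lemma outer_billiardP B : is_outer_billiard (@hopf_field R) (@lower R) B <->
  forall q, lower q -> B q = billiard q.
Proof.
split=> [[_ BE] q Uq|BE].
  have [t t0 te] := sech_surj Uq.
  have [g gN] := horo_geodesic_billiard (tail4 (straighten (-1) q)) t0.
  have := BE (tail4 (straighten (-1) q)) _ t0; rewrite g gN te.
  have -> : cons4 (q 0 0) (tail4 (straighten (-1) q)) = straighten (-1) q.
    by rewrite -[RHS]cons4_eta {3}/straighten cons4E0.
  by rewrite straightenK.
split=> [q Uq|p t t0]; first by rewrite BE//; exact: lower_billiard.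
have [-> ->] := horo_geodesic_billiard p t0; rewrite BE.
  by rewrite /billiard unstraightenK.
by apply: lower_unstraighten; rewrite lower_cons4 sech_itv.
Qed.

Lemma pt4E h x y z : pt4 h x y z = cons4 h (pt3 x y z).
Proof.
apply/rowP => k; have [->|[j ->]] := ord4P k; first by rewrite cons4E0 mxE.
rewrite row4_mxES !mxE/=; case: j => -[|[|[|//]]] //.
Qed.

Lemma lower_pt4 h x y z : 0 < h < 1 -> lower (pt4 h x y z).
Proof. by rewrite pt4E lower_cons4. Qed.

Lemma billiard_pt4 h x y z (s := Num.sqrt (1 - h ^+ 2)) :
  billiard (pt4 h x y z) = cons4 h (hopf_push s (hopf_pull (- s) (pt3 x y z))).
Proof.
rewrite /billiard /unstraighten /straighten pt4E !cons4E0 !cons4K mul1r mulN1r.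
by [].
Qed.

Lemma billiard_axis h x :
  billiard (pt4 h x 0 0) = pt4 h (x + 2 * Num.sqrt (1 - h ^+ 2)) 0 0.
Proof.
rewrite billiard_pt4 pt4E; set s := Num.sqrt _; congr cons4.
have push u a : hopf_push u (pt3 a 0 0) = pt3 (a + u) 0 0.
  rewrite hopf_pushE; have a0 := neq0_1Dsqr a.
  by congr pt3; rewrite ?expr0n ?addr0 ?mul0r ?subr0 ?mul0r //; field.
have -> : pt3 x 0 0 = hopf_push (- s) (pt3 (x + s) 0 0) by rewrite push addrK.
by rewrite hopf_pushK push -addrA -mulr2n mulr_natl.
Qed.

Lemma cos_2atan (s : R) : cos (2 * atan s) = (1 - s ^+ 2) / (1 + s ^+ 2).
Proof.
rewrite mulr_natl cos_mulr2n cos_atan exprVn sqr_sqrtr; last exact/ltW/gt0_1Dsqr.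
by have s0 := neq0_1Dsqr s; field.
Qed.

Lemma sin_2atan (s : R) : sin (2 * atan s) = 2 * s / (1 + s ^+ 2).
Proof.
have c0 : cos (atan s) != 0.
  by rewrite cos_atan invr_eq0 sqrtr_eq0 -ltNge gt0_1Dsqr.
rewrite mulr_natl sin_mulr2n -[sin _](divfK c0) -/(tan (atan s)) atanK.
have -> : cos (atan s) * (s * cos (atan s)) = s * cos (atan s) ^+ 2 by ring.
rewrite cos_atan exprVn sqr_sqrtr; last exact/ltW/gt0_1Dsqr.
by have s0 := neq0_1Dsqr s; field.
Qed.

Lemma billiard_circle h y z : 0 < h < 1 -> y ^+ 2 + z ^+ 2 = 2 - h ^+ 2 ->
  billiard (pt4 h 0 y z) = rotate (2 * atan (Num.sqrt (1 - h ^+ 2))) h y z.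
Proof.
move=> /andP[h0 h1] yz; rewrite billiard_pt4 /rotate pt4E; congr cons4.
rewrite cos_2atan sin_2atan; set s := Num.sqrt _.
have s2 : s ^+ 2 = 1 - h ^+ 2 by rewrite sqr_sqrtr// subr_ge0 expr_le1// ltW.
have {}yz : y ^+ 2 = 1 + s ^+ 2 - z ^+ 2 by rewrite s2; move: yz; lra.
have s0 := neq0_1Dsqr s.
(* The foot point is $(0,w/(1+is))$, on the unit circle because $|w|^2=1+s^2$. *)
have -> : hopf_pull (- s) (pt3 0 y z) =
    pt3 0 ((y + s * z) / (1 + s ^+ 2)) ((z - s * y) / (1 + s ^+ 2)).
  rewrite /hopf_pull !pt3E add0r sqrrN.
  have -> : 1 + s ^+ 2 + y ^+ 2 + z ^+ 2 = 2 * (1 + s ^+ 2) by rewrite yz; ring.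
  have -> : - s - 2 * - s * (1 + s ^+ 2) / (2 * (1 + s ^+ 2)) = 0 by field.
  by congr pt3; congr (_ / _); ring.
rewrite hopf_pushE.
(* For $x=0$ and $|w|=1$ the shift $m$ equals $s$, so the image has first coordinate $0$ again. *)
have -> : 2 * s * (1 + 0 ^+ 2) / (1 + 0 ^+ 2 + ((y + s * z) / (1 + s ^+ 2)) ^+ 2 +
    ((z - s * y) / (1 + s ^+ 2)) ^+ 2) = s.
  have -> : 1 + 0 ^+ 2 + ((y + s * z) / (1 + s ^+ 2)) ^+ 2 +
      ((z - s * y) / (1 + s ^+ 2)) ^+ 2 = 1 + (y ^+ 2 + z ^+ 2) / (1 + s ^+ 2).
    by field.
  by rewrite yz subrK divff//; field.
by congr pt3; field.
Qed.

Lemma rotateD (a b : R) h y z :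
  rotate (a + b) h y z =
  rotate a h (cos b * y + sin b * z) (- sin b * y + cos b * z).
Proof. by rewrite /rotate cosD sinD; congr pt4; ring. Qed.

(** Pairing the rotated vector with $(y,z)$ kills the sine terms and leaves $\cos a\,(y^2+z^2)$. *)
Lemma rotate_eqP (a : R) h y z : y ^+ 2 + z ^+ 2 != 0 ->
  rotate a h y z = pt4 h 0 y z <-> cos a = 1.
Proof.
move=> yz; split=> [|ca]; rewrite /rotate.
  rewrite !pt4E => /(congr1 (@tail4 R)); rewrite !cons4K => /rowP e.
  have := e 1; have := e 2%:R; rewrite !pt3E => e2 e1.
  apply: (mulIf yz); rewrite mul1r mulrDr.
  rewrite -[X in _ = X + _]mulr1 -[X in _ = _ + X]mulr1 !expr2.
  by rewrite -{3}e1 -{5}e2; ring.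
have sa : sin a = 0 by apply/cos1sin0; rewrite ca normr1.
by rewrite ca sa; congr pt4; ring.
Qed.

Lemma hopf_circle_rotate (a : R) h y z : y ^+ 2 + z ^+ 2 = 2 - h ^+ 2 ->
  hopf_circle h (rotate a h y z).
Proof.
move=> yz; exists (cos a * y + sin a * z, - sin a * y + cos a * z) => //=.
have := cos2Dsin2 a => e; rewrite -yz -[RHS]mul1r -e; ring.
Qed.

Section Iterates.
Variables (B : 'rV[R]_4 -> 'rV[R]_4) (h : R).
Hypotheses (BE : forall q, lower q -> B q = billiard q) (h01 : 0 < h < 1).

Let s := Num.sqrt (1 - h ^+ 2).

Lemma set_bij_outer_billiard : set_bij (@lower R) (@lower R) B.
Proof.
apply: (eq_set_bijLR _ set_bij_billiard) => q /set_mem; exact: BE.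
Qed.

Lemma iterz_axis x (m : int) :
  iterz (@lower R) B m (pt4 h x 0 0) = pt4 h (x + 2 * m%:~R * s) 0 0.
Proof.
have step (f : 'rV[R]_4 -> 'rV[R]_4) (d : R) (n : nat) :
    (forall x, f (pt4 h x 0 0) = pt4 h (x + d) 0 0) ->
    iter n f (pt4 h x 0 0) = pt4 h (x + d *+ n) 0 0.
  move=> fd; elim: n => [|n IH]; first by rewrite addr0.
  by rewrite iterS IH fd mulrSr addrA.
have B1 y : B (pt4 h y 0 0) = pt4 h (y + 2 * s) 0 0.
  by rewrite BE ?billiard_axis//; exact: lower_pt4.
have [_ inj _] := set_bij_outer_billiard.
have B2 y : 'pinv_id (@lower R) B (pt4 h y 0 0) = pt4 h (y + - (2 * s)) 0 0.
  (* The point over $y$ is the image under [B] of the point over $y-2s$, and [B] is injective on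
     [lower]. *)
  rewrite -{1}(subrK (2 * s) y) -B1 pinvKV//.
  by apply/mem_set/lower_pt4.
case: m => n; rewrite /iterz.
  rewrite (step _ _ _ B1) -pmulrn; congr pt4; rewrite -mulr_natr; ring.
rewrite (step _ _ _ B2) NegzE mulrNz -pmulrn; congr pt4; rewrite -mulr_natr; ring.
Qed.

Lemma unbounded_axis x :
  ~ bounded_set [set iterz (@lower R) B m (pt4 h x 0 0) | m in [set: int]].
Proof.
have s0 : 0 < s.
  by have /andP[h0 h1] := h01; rewrite sqrtr_gt0 subr_gt0 expr_lt1// ltW.
move=> /pinfty_ex_gt0[M M0 HM].
(* With $ns>M+|x|$ the coordinate $x+2ns$ exceeds $M$, and it is at most the sup norm. *)
have := archi_boundP (divr_ge0 (addr_ge0 (ltW M0) (normr_ge0 x)) (ltW s0)).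
set n := Num.bound _; rewrite ltr_pdivrMr// => nM.
have := HM (iterz (@lower R) B n (pt4 h x 0 0)); rewrite iterz_axis => HMn.
have : `|pt4 h (x + 2 * (n%:Z)%:~R * s) 0 0| <= M.
  by apply: HMn; exists n%:Z => //; exact: iterz_axis.
apply/negP; rewrite -ltNge.
apply: (@lt_le_trans _ _ `|(pt4 h (x + 2 * (n%:Z)%:~R * s) 0 0) 0 1|); last first.
  rewrite [leRHS]/Num.Def.normr/= mx_normrE.
  exact: (le_bigmax _ (fun i : 'I_1 * 'I_4 => `|pt4 h (x + 2 * (n%:Z)%:~R * s) 0 0 i.1 i.2|) (0, 1)).
rewrite mxE/= -pmulrn (lt_le_trans _ (ler_norm _))//.
have := ler_norm (- x); rewrite normrN.
have : 0 <= n%:R * s by rewrite mulr_ge0// ltW.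
lra.
Qed.

Let theta := 2 * atan s.

Lemma outer_billiard_circle y z : y ^+ 2 + z ^+ 2 = 2 - h ^+ 2 ->
  B (pt4 h 0 y z) = rotate theta h y z.
Proof. by move=> yz; rewrite BE ?billiard_circle//; exact: lower_pt4. Qed.

Lemma outer_billiard_circle_image : B @` hopf_circle h = hopf_circle h.
Proof.
apply/seteqP; split=> [_ [_ [[y z] /= yz <-] <-]|_ [[y z] /= yz <-]].
  by rewrite outer_billiard_circle//; exact: hopf_circle_rotate.
(* The preimage is the point rotated by $-\theta$. *)
have [[y' z'] /= yz' e] := hopf_circle_rotate (- theta) yz.
exists (pt4 h 0 y' z'); first by exists (y', z').
rewrite outer_billiard_circle//; move: e; rewrite {1}/rotate !pt4E.
move=> /(congr1 (@tail4 R)); rewrite !cons4K => /rowP e.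
have := e 1; have := e 2%:R; rewrite !pt3E => -> ->.
by rewrite -rotateD subrr /rotate cos0 sin0 pt4E; congr (cons4 _ (pt3 _ _ _)); ring.
Qed.

Lemma iter_outer_billiard_circle n y z : y ^+ 2 + z ^+ 2 = 2 - h ^+ 2 ->
  iter n B (pt4 h 0 y z) = rotate (theta *+ n) h y z.
Proof.
move=> yz; elim: n => [|n IH].
  by rewrite mulr0n /rotate cos0 sin0 /=; congr pt4; ring.
rewrite iterS IH mulrS rotateD {1}/rotate outer_billiard_circle//.
have := cos2Dsin2 (theta *+ n) => e; rewrite -yz -[RHS]mul1r -e; ring.
Qed.

Lemma outer_billiard_periodic q : hopf_circle h q ->
  (exists2 n : nat, (0 < n)%N & iter n B q = q) <->
  (exists r : rat, theta = ratr r * pi).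
Proof.
move=> [[y z] /= yz <-]; rewrite -mulrn_2pi.
have yz0 : y ^+ 2 + z ^+ 2 != 0.
  have /andP[h0 h1] := h01; rewrite yz gt_eqF// subr_gt0.
  by rewrite (@lt_trans _ _ 1)// ?ltr1n// expr_lt1// ltW.
by split=> -[n n0 e]; exists n => //; move: e;
  rewrite iter_outer_billiard_circle// => /(rotate_eqP _ _ yz0).
Qed.

End Iterates.

End OuterBilliard.

Theorem proposition17 (R : realType) :
  let U := @lower R in
  let v := @hopf_field R in
  bifoliates v U /\
  (exists B : 'rV[R]_4 -> 'rV[R]_4, is_outer_billiard v U B) /\
  forall B : 'rV[R]_4 -> 'rV[R]_4, is_outer_billiard v U B ->
    set_bij U U B /\
    forall h : R, 0 < h < 1 ->
      (forall x : R,
         (forall m : int,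
            iterz U B m (pt4 h x 0 0) =
            pt4 h (x + 2 * m%:~R * Num.sqrt (1 - h ^+ 2)) 0 0) /\
         ~ bounded_set [set iterz U B m (pt4 h x 0 0) | m in [set: int]]) /\
      B @` hopf_circle h = hopf_circle h /\
      (let theta := 2 * atan (Num.sqrt (1 - h ^+ 2)) in
       (forall y z : R, hopf_circle h (pt4 h 0 y z) ->
          B (pt4 h 0 y z) = rotate theta h y z) /\
       (forall q : 'rV[R]_4, hopf_circle h q ->
          (exists2 n : nat, (0 < n)%N & iter n B q = q) <->
          (exists r : rat, theta = ratr r * pi))).
Proof.
move=> U v; split; last split.
- split.
    rewrite (_ : v = fun p => 1 *: hopf_field p).
      exact/foliation_horo_rays/expr1n.
    by apply/funext => p; rewrite scale1r.
  rewrite (_ : (fun p => - v p) = fun p => -1 *: hopf_field p).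
    by apply: foliation_horo_rays; rewrite sqrrN expr1n.
  by apply/funext => p; rewrite scaleN1r.
- by exists (@billiard R); apply/outer_billiardP.
move=> B /outer_billiardP BE; split; first exact: set_bij_outer_billiard.
move=> h h01; split=> [x|].
  split=> [m|]; [exact: iterz_axis|exact: unbounded_axis].
split; first exact: outer_billiard_circle_image.
split=> [y z [[y' z'] /= yz e]|q]; last exact: outer_billiard_periodic.
move: e; rewrite !pt4E => /(congr1 (@tail4 R)); rewrite !cons4K => /rowP e.
have := e 1; have := e 2%:R; rewrite !pt3E -pt4E => <- <-.
exact: outer_billiard_circle.
Qed.
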